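(* Let $f:\mathbb{R}^n\to\mathbb{R}$ and $g:\mathbb{R}^m\to\mathbb{R}$ be continuously differentiable and convex, let $A\in\mathbb{R}^{m\times n}$ with $m\ge n$ have full column rank, and let $V(x)=f(x)+g(Ax)$. Let $X^\star$ be a strict local minimizer and an isolated stationary point of $V$, i.e., there exists an open set $\mathcal{O}\subseteq\mathbb{R}^n$ such that $X^\star\in\mathcal{O}$, $\nabla V(X)\neq0$ for all $X\in\mathcal{O}\setminus\{X^\star\}$, and $V(X)>V(X^\star)$ for all $X\in\mathcal{O}\setminus\{X^\star\}$. Then $X^\star$ is an asymptotically stable critical point of the ADMM flow $$\dot X+(A^TA)^{-1}\nabla V(X)=0 .$$
   Context: For a dynamical system $\dot Y=F(Y,t)$, $Y(t_0)=Y_0$, with $Y(t)\in\mathbb{R}^p$, a point $Y^\star$ with $F(Y^\star,t)=0$ for all $t\ge t_0$ is called a critical point. A critical point $Y^\star$ is stable if for every neighborhood $\mathcal{N}\subseteq\mathbb{R}^p$ of $Y^\star$ there is a neighborhood $\bar{\mathcal{N}}\subseteq\mathcal{N}$ of $Y^\star$ such that every solution $Y(t)$ with initial condition $Y(t_0)=Y_0\in\bar{\mathcal{N}}$ is defined (i.e. its maximal forward extension is defined) and remains in $\mathcal{N}$ for all $t>t_0$. It is asymptotically stable if it is stable and, additionally, the neighborhood $\bar{\mathcal{N}}$ can be chosen so that $\lim_{t\to\infty}Y(t)=Y^\star$ for all $Y_0\in\bar{\mathcal{N}}$. *)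

(* Defs.v *)
From HB Require Import structures.
From mathcomp Require Import all_boot all_order all_algebra.
From mathcomp Require Import all_classical all_reals all_analysis.

Set Implicit Arguments.
Unset Strict Implicit.
Unset Printing Implicit Defensive.

Import Order.TTheory GRing.Theory Num.Theory.
Import numFieldNormedType.Exports.

Local Open Scope classical_set_scope.
Local Open Scope ring_scope.

Section DynamicalSystem.
Context {R : realType} {p : nat}.
Variables (F : 'cV[R]_p -> R -> 'cV[R]_p) (t0 : R).
Implicit Types (Y : R -> 'cV[R]_p) (T : \bar R).

(* A solution of Y' = F(Y, t) on [t0, T[, where T may be +oo.  The derivative
   at the initial time is one-sided; the values of the total function Y
   outside [t0, T[ are irrelevant. *)
Definition is_solution T Y : Prop :=
  [/\ (t0%:E < T)%E,
      h^-1 *: (Y (t0 + h) - Y t0) @[h --> 0^'+] --> F (Y t0) t0 &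
      forall t : R, t0 < t -> (t%:E < T)%E -> is_derive t 1 Y (F (Y t) t)].

Definition maximal_solution T Y : Prop :=
  is_solution T Y /\
  ~ (exists T' Z, [/\ (T < T')%E, is_solution T' Z &
       forall t : R, t0 <= t -> (t%:E < T)%E -> Z t = Y t]).

Definition critical_point (Ystar : 'cV[R]_p) : Prop :=
  forall t : R, t0 <= t -> F Ystar t = 0.

Definition solutions_remain (Nbar N : set 'cV[R]_p) : Prop :=
  forall T Y, maximal_solution T Y -> Nbar (Y t0) ->
    T = +oo%E /\ (forall t : R, t0 < t -> N (Y t)).

(* Meant to be used with [solutions_remain Nbar N], which forces T = +oo. *)
Definition solutions_converge (Nbar : set 'cV[R]_p) (Ystar : 'cV[R]_p) : Prop :=
  forall T Y, maximal_solution T Y -> Nbar (Y t0) ->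
    Y t @[t --> +oo] --> Ystar.

Definition stable (Ystar : 'cV[R]_p) : Prop :=
  forall N, nbhs Ystar N ->
    exists Nbar, [/\ nbhs Ystar Nbar, Nbar `<=` N & solutions_remain Nbar N].

Definition asymptotically_stable (Ystar : 'cV[R]_p) : Prop :=
  stable Ystar /\
  forall N, nbhs Ystar N ->
    exists Nbar, [/\ nbhs Ystar Nbar, Nbar `<=` N, solutions_remain Nbar N &
                     solutions_converge Nbar Ystar].

End DynamicalSystem.

Section ADMMFlow.
Context {R : realType}.

Definition gradient (n : nat) (V : 'cV[R]_n -> R) (x : 'cV[R]_n) : 'cV[R]_n :=
  \col_(i < n) 'D_(delta_mx i 0) V x.

Definition continuously_differentiable (n : nat) (V : 'cV[R]_n -> R) : Prop :=
  (forall x, differentiable V x) /\ continuous (gradient V).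

Definition composite_objective (m n : nat) (f : 'cV[R]_n -> R)
    (g : 'cV[R]_m -> R) (A : 'M[R]_(m, n)) (x : 'cV[R]_n) : R :=
  f x + g (A *m x).

Definition admm_flow (m n : nat) (A : 'M[R]_(m, n)) (V : 'cV[R]_n -> R)
    (x : 'cV[R]_n) (_ : R) : 'cV[R]_n :=
  - (invmx (A^T *m A) *m gradient V x).

Definition isolated_strict_minimizer (n : nat) (V : 'cV[R]_n -> R)
    (Xstar : 'cV[R]_n) : Prop :=
  exists O : set 'cV[R]_n,
    [/\ open O, O Xstar,
        (forall x, O x -> x <> Xstar -> gradient V x <> 0) &
        (forall x, O x -> x <> Xstar -> V Xstar < V x)].

End ADMMFlow.

(* Main.v *)
(** [V] is a strict Lyapunov function of the flow: along solutions
    [V(X)' = - (grad V)^T (A^T A)^-1 (grad V)], which is negative wherever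
    [grad V <> 0] because [A] has full column rank.  Since [V] is at least
    some [c > V Xstar] on a small sphere around the minimizer, the part of the ball
    where [V < c] is forward invariant; there [V], hence the distance to the
    minimizer, tends to its minimum.  A bounded solution on [t0, T[ with [T]
    finite has a limit at [T] and is prolonged by a Peano solution, so it is
    not maximal. *)

Require Import Defs.
From HB Require Import structures.
From mathcomp Require Import all_boot all_order all_algebra.
From mathcomp Require Import all_classical all_reals all_analysis.
From mathcomp Require Import ring lra.

Set Implicit Arguments.
Unset Strict Implicit.
Unset Printing Implicit Defensive.

Import Order.TTheory GRing.Theory Num.Theory.
Import numFieldNormedType.Exports.

Local Open Scope classical_set_scope.
Local Open Scope ring_scope.

(** * Matrix norms, compactness and ultrafilter limits *)

Section Topology.
Context {R : realType}.

(** The norm is a maximum over finitely many entries, so the eventual bounds on the entries hold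
    simultaneously. *)
Lemma cvg_mx_coord (T : Type) (m n : nat) (F : set_system T)
    (f : T -> 'M[R]_(m, n)) (M : 'M[R]_(m, n)) : Filter F ->
  (forall i j, f x i j @[x --> F] --> M i j) -> f x @[x --> F] --> M.
Proof.
move=> FF fM; apply/cvgrPdist_le => e e0.
near=> x.
rewrite /Num.Def.normr/= mx_normrE (bigmax_le _ (ltW e0))//= => i _.
rewrite !mxE; move: i; near: x; apply: filter_forall => i.
by apply: (cvgrPdist_le _ _).1 => //; exact: fM.
Unshelve. all: by end_near. Qed.

Lemma mulmx_continuous (m n p : nat) (A : 'M[R]_(m, n)) :
  continuous (fun x : 'M[R]_(n, p) => A *m x).
Proof.
move=> x; apply: (@cvg_mx_coord _ _ _ (nbhs x)) => i j.
under eq_fun do rewrite mxE.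
rewrite mxE; apply: cvg_big => [|k _]; first exact: add_continuous.
by apply: cvgMl_tmp; exact: coord_continuous.
Qed.

Lemma trmx_continuous (m n : nat) :
  continuous (fun x : 'M[R]_(m, n) => x^T).
Proof.
move=> x; apply: (@cvg_mx_coord _ _ _ (nbhs x)) => i j.
under eq_fun do rewrite mxE.
by rewrite mxE; exact: coord_continuous.
Qed.

Lemma le_mx_norm (m n : nat) (M : 'M[R]_(m, n)) i j : `|M i j| <= `|M|.
Proof.
rewrite [leRHS]/Num.Def.normr/= mx_normrE.
exact: (le_bigmax _ (fun k : 'I_m * 'I_n => `|M k.1 k.2|) (i, j)).
Qed.

Lemma mx_norm_le (m n : nat) (M : 'M[R]_(m, n)) (e : R) : 0 <= e ->
  (forall i j, `|M i j| <= e) -> `|M| <= e.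
Proof.
move=> e0 Me; rewrite /Num.Def.normr/= mx_normrE.
by apply: bigmax_le => // k _; exact: Me.
Qed.

(** Heine-Borel for row vectors, carried over to columns by the continuous transposition. *)
Lemma cV_bounded_closed_compact (n : nat) (K : set 'cV[R]_n) (c : 'cV[R]_n)
    (r : R) : closed K -> (forall x, K x -> `|x - c| <= r) -> compact K.
Proof.
move=> cK Kr; pose K' := [set x : 'rV[R]_n | K x^T].
have -> : K = (fun x => x^T) @` K'.
  rewrite eqEsubset; split=> [x Kx|_ [x Kx <-]//].
  by exists x^T; rewrite /K' /= ?trmxK.
apply: continuous_compact; first exact/continuous_subspaceT/trmx_continuous.
apply: bounded_closed_compact; last first.
  by apply: closed_comp => // x _; exact: trmx_continuous.
exists (r + `|c|); split; first exact: num_real.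
move=> M rM x Kx; apply/ltW/(le_lt_trans _ rM).
have -> : x = ((x^T - c) + c)^T by rewrite subrK trmxK.
apply: (@le_trans _ _ `|(x^T - c) + c|).
  by apply: mx_norm_le => // i j; rewrite mxE; exact: le_mx_norm.
by apply: (le_trans (ler_normD _ _)); rewrite lerD2r; exact: Kr.
Qed.

Lemma dist_continuous (W : normedModType R) (c : W) :
  continuous (fun x => `|x - c|).
Proof.
by move=> x; apply: cvg_norm; apply: cvgB; [exact: cvg_id|exact: cvg_cst].
Qed.

Lemma cV_closed_ball_compact (n : nat) (c : 'cV[R]_n) (r : R) :
  compact [set x | `|x - c| <= r].
Proof.
apply: (@cV_bounded_closed_compact _ _ c r) => //.
have -> : [set x : 'cV[R]_n | `|x - c| <= r] =
  (fun x => `|x - c|) @^-1` [set s : R | s <= r] by [].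
apply: preimage_closed.
  by move=> x _; exact: dist_continuous.
exact: closed_le.
Qed.

Lemma compact_ge (T : topologicalType) (K : set T) (h : T -> R) (c : R) :
  compact K -> continuous h -> compact (K `&` [set x | c <= h x]).
Proof.
move=> cK ch; apply: compact_closedI => //.
have -> : [set x | c <= h x] = h @^-1` [set s : R | c <= s] by [].
apply: preimage_closed => [x _|]; first exact: ch.
exact: closed_ge.
Qed.

(** Compactness gives a cluster point [x]. If the preimage of a neighborhood of [x] were not in [U],
    its complement would be, and this contradicts clustering. *)
Lemma compact_ultra_cvg (T : topologicalType) (I : Type) (U : set_system I)
    (f : I -> T) (K : set T) : UltraFilter U -> compact K ->
  (\forall i \near U, K (f i)) -> exists2 x, K x & f i @[i --> U] --> x.
Proof.
move=> UU cK UK; have [x [Kx clx]] := cK (f @ U) _ UK.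
exists x => // B Bx.
have [//|UC] := in_ultra_setVsetC (f @^-1` B) UU.
by have [y []] := clx (~` B) B UC Bx.
Qed.

(** The minimum is attained, which makes the strict bound uniform; if [K] is empty, [c + 1]
    serves. *)
Lemma compact_gt_lower_bound (T : topologicalType) (K : set T) (h : T -> R)
    (c : R) : compact K -> continuous h -> (forall x, K x -> c < h x) ->
  exists2 d, c < d & forall x, K x -> d <= h x.
Proof.
move=> cK ch Kc; have [->|K0] := eqVneq K set0.
  by exists (c + 1); rewrite ?ltrDl.
have [||x /set_mem Kx xmin] := @compact_EVT_min _ _ h K _ cK.
- exact/set0P.
- exact: continuous_subspaceT.
- by exists (h x); [exact: Kc|move=> y Ky; apply: xmin; exact: mem_set].
Qed.

Lemma continuous_dist_le (W1 W2 : normedModType R) (f : W1 -> W2) (y : W1)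
    (e : R) : {for y, continuous f} -> 0 < e ->
  exists2 d, 0 < d & forall x, `|x - y| < d -> `|f x - f y| <= e.
Proof.
move=> fy e0; have [d /= d0 dP] := (nbhs_ballP _ _).1 ((cvgrPdist_le _ _).1 fy e e0).
exists d => // x xd; rewrite distrC; apply: dP.
by rewrite -ball_normE/= distrC.
Qed.

End Topology.

(** * Mean value estimate and one-sided derivatives *)

Section Derivatives.
Context {R : realType}.

Lemma is_derive_mx_coord (m n : nat) (Y : R -> 'M[R]_(m, n)) (x : R) dy i j :
  is_derive x 1 Y dy -> is_derive x 1 (fun t => Y t i j) (dy i j).
Proof.
move=> [dY <-]; apply: DeriveDef; first by have /derivable_mxP := dY; exact.
by rewrite derive_mx// mxE.
Qed.

(** The scalar mean value theorem is applied to each entry. The intermediate points may differ from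
    entry to entry, which is harmless for the max norm. *)
Lemma mean_value_estimate (m n : nat) (Y dY : R -> 'M[R]_(m, n))
    (v : 'M[R]_(m, n)) (e s t : R) : s <= t -> 0 <= e ->
  {within `[s, t], continuous Y} ->
  (forall x, s < x < t -> is_derive x 1 Y (dY x)) ->
  (forall x, s <= x <= t -> `|dY x - v| <= e) ->
  `|Y t - Y s - (t - s) *: v| <= e * (t - s).
Proof.
move=> st e0 cY dYP dYv; have ts0 : 0 <= t - s by rewrite subr_ge0.
apply: mx_norm_le => [|i j]; first exact: mulr_ge0.
have [||c] := @MVT_segment _ (fun x => Y x i j) (fun x => dY x i j) _ _ st.
- move=> x /itvP xst; apply: is_derive_mx_coord; apply: dYP.
  by rewrite !xst.
- move=> x; apply: (cvg_comp Y (fun M : 'M[R]_(m, n) => M i j) (cY x)).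
  exact: coord_continuous.
- rewrite in_itv/= => cst Yst; rewrite !mxE Yst.
  rewrite [(t - s) * _]mulrC -mulrBl normrM (ger0_norm ts0) ler_wpM2r//.
  apply: le_trans (dYv c cst); have := le_mx_norm (dY c - v) i j.
  by rewrite !mxE.
Qed.

Lemma cvg_right_quotient (W : normedModType R) (Y : R -> W) (s : R) (v : W) :
  (forall e, 0 < e -> exists2 d, 0 < d & forall h, 0 < h < d ->
    `|Y (s + h) - Y s - h *: v| <= e * h) ->
  h^-1 *: (Y (s + h) - Y s) @[h --> 0^'+] --> v.
Proof.
move=> dY; apply/cvgrPdist_le => e /dY[d d0 dP].
near=> h.
have h0 : 0 < h by near: h; exact: nbhs_right_gt.
have -> : v - h^-1 *: (Y (s + h) - Y s) =
    - (h^-1 *: (Y (s + h) - Y s - h *: v)).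
  by rewrite [in RHS]scalerBr scalerA mulVf ?gt_eqF// scale1r opprB.
rewrite normrN normrZ gtr0_norm ?invr_gt0// mulrC ler_pdivrMr//.
by apply: dP; rewrite h0/=; near: h; exact: nbhs_right_lt.
Unshelve. all: by end_near. Qed.

Lemma cvg_left_quotient (W : normedModType R) (Y : R -> W) (s : R) (v : W) :
  (forall e, 0 < e -> exists2 d, 0 < d & forall h, 0 < h < d ->
    `|Y s - Y (s - h) - h *: v| <= e * h) ->
  h^-1 *: (Y (s + h) - Y s) @[h --> 0^'-] --> v.
Proof.
move=> dY; apply/cvgrPdist_le => e /dY[d d0 dP].
near=> h.
have h0 : h < 0 by near: h; exact: nbhs_left_lt.
have -> : v - h^-1 *: (Y (s + h) - Y s) =
    h^-1 *: (Y s - Y (s - (- h)) - (- h) *: v).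
  rewrite scaleNr !opprK [in RHS]scalerDr scalerA mulVf ?lt_eqF// scale1r.
  by rewrite addrC -scalerN opprB.
rewrite normrZ ltr0_norm ?invr_lt0// mulrC -invrN ler_pdivrMr ?oppr_gt0//.
apply: dP; rewrite oppr_gt0 h0/= ltrNl; near: h.
by apply: nbhs_left_gt; rewrite oppr_lt0.
Unshelve. all: by end_near. Qed.

(** Needed where two solutions are glued, since the two sides then come from different estimates. *)
Lemma is_derive_sides (W : normedModType R) (Y : R -> W) (s : R) (v : W) :
  h^-1 *: (Y (s + h) - Y s) @[h --> 0^'+] --> v ->
  h^-1 *: (Y (s + h) - Y s) @[h --> 0^'-] --> v ->
  is_derive s 1 Y v.
Proof.
move=> Yr Yl; have Yv : h^-1 *: (Y (h *: 1 + s) - Y s) @[h --> 0^'] --> v.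
  under eq_fun do rewrite [_ *: 1]mulr1 [_ + s]addrC.
  apply/cvgrPdist_le => e e0.
  have [a /= a0 aP] := (cvgrPdist_le _ _).1 Yr e e0.
  have [b /= b0 bP] := (cvgrPdist_le _ _).1 Yl e e0.
  exists (Num.min a b) => /=; first by rewrite lt_min a0.
  move=> h; rewrite /ball/= lt_min => /andP[ha hb].
  by rewrite neq_lt => /orP[h0|h0]; [exact: bP|exact: aP].
by split; [apply/cvg_ex; exists v|exact: cvg_lim].
Qed.

(** The increment is [h] times the quotient, hence tends to [0 *: v]. *)
Lemma right_quotient_cvg (W : normedModType R) (Y : R -> W) (s : R) (v : W) :
  h^-1 *: (Y (s + h) - Y s) @[h --> 0^'+] --> v -> Y x @[x --> s^'+] --> Y s.
Proof.
move=> Yv; have Y0 : h *: (h^-1 *: (Y (s + h) - Y s)) @[h --> 0^'+] --> 0.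
  rewrite -(scale0r v); apply: cvgZ => //.
  by apply: cvg_within_filter; exact: cvg_id.
apply/cvgrPdist_lt => e e0.
have [d /= d0 dP] := (cvgrPdist_lt _ _).1 Y0 e e0.
exists d => //= x; rewrite /ball/= => xd sx.
have := dP (x - s); rewrite /ball/= sub0r normrN distrC => /(_ xd).
rewrite subr_gt0 sub0r normrN scalerA mulfV ?subr_eq0 ?gt_eqF// scale1r.
by rewrite [s + _]addrC subrK distrC => /(_ sx).
Qed.

End Derivatives.

(** * Peano's existence theorem by Euler polygons *)

Section Peano.
Context {R : realType} {p : nat}.
Variable F : 'cV[R]_p -> 'cV[R]_p.

Definition euler (h : R) (y0 : 'cV[R]_p) (k : nat) : 'cV[R]_p :=
  iter k (fun x => x + h *: F x) y0.

(** Discrete mean value estimate: the error telescopes, and each step adds [h *: (F x - v)] with [x]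
    the current vertex. *)
Lemma euler_estimate h y0 v e i d : 0 <= h ->
  (forall k, (k < d)%N -> `|F (euler h y0 (i + k)) - v| <= e) ->
  `|euler h y0 (i + d) - euler h y0 i - (d%:R * h) *: v| <= e * (d%:R * h).
Proof.
move=> h0; elim: d => [|d IHd] Fv.
  by rewrite addn0 !mul0r mulr0 subrr scale0r subr0 normr0.
have -> : euler h y0 (i + d.+1) - euler h y0 i - (d.+1%:R * h) *: v =
    (euler h y0 (i + d) - euler h y0 i - (d%:R * h) *: v) +
    h *: (F (euler h y0 (i + d)) - v).
  rewrite addnS /= -/(euler h y0 (i + d)) -natr1.
  by apply/matrixP => k l; rewrite !mxE; ring.
apply: (le_trans (ler_normD _ _)).
rewrite -natr1 mulrDl mul1r mulrDr lerD//.
  by apply: IHd => k kd; apply: Fv; exact: ltnW.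
by rewrite normrZ ger0_norm// mulrC ler_wpM2r// Fv.
Qed.

(** Induction on [k]: as long as the path length [k%:R * h * M] is below [r], the current vertex is
    in the ball where the speed bound [M] applies to the next step. *)
Lemma euler_in_ball h y0 r M k : 0 <= h -> 0 <= M ->
  (forall x, `|x - y0| < r -> `|F x| <= M) ->
  k%:R * h * M < r -> `|euler h y0 k - y0| <= k%:R * h * M.
Proof.
move=> h0 M0 FM; elim: k => [_|k IHk kr].
  by rewrite /euler/= subrr normr0 !mul0r.
have kk : k%:R * h * M <= k.+1%:R * h * M.
  by rewrite !ler_wpM2r// ler_nat.
have xk := IHk (le_lt_trans kk kr).
rewrite /= -/(euler h y0 k) addrAC -natr1 !mulrDl mul1r.
apply: (le_trans (ler_normD _ _)); rewrite lerD// normrZ ger0_norm//.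
by rewrite ler_wpM2l// FM// (le_lt_trans xk)// (le_lt_trans kk).
Qed.

Lemma euler_lipschitz h y0 r M i j : 0 <= h -> 0 <= M ->
  (forall x, `|x - y0| < r -> `|F x| <= M) -> (i <= j)%N ->
  j%:R * h * M < r ->
  `|euler h y0 j - euler h y0 i| <= M * ((j%:R - i%:R) * h).
Proof.
move=> h0 M0 FM ij jr.
have := @euler_estimate h y0 0 M i (j - i) h0.
rewrite subnKC// scaler0 subr0 natrB//; apply=> k kd.
have kr : (i + k)%:R * h * M < r.
  apply: le_lt_trans jr; rewrite !ler_wpM2r// ler_nat.
  by rewrite -(subnKC ij) leq_add2l ltnW.
by rewrite subr0 FM// (le_lt_trans _ kr)// (@euler_in_ball _ _ r).
Qed.

(** All vertices from [i] to [j] are within [M * ((j%:R - i%:R) * h)] of vertex [l], hence within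
    [rho] of [y]. There [F] differs from [F y] by at most [e], so [euler_estimate] applies with
    [v := F y]. *)
Lemma euler_straddle h y0 r M i l j y e rho : 0 <= h -> 0 <= M ->
  (forall x, `|x - y0| < r -> `|F x| <= M) ->
  (forall x, `|x - y| < rho -> `|F x - F y| <= e) ->
  (i <= l <= j)%N -> j%:R * h * M < r ->
  M * ((j%:R - i%:R) * h) + `|euler h y0 l - y| < rho ->
  `|euler h y0 j - euler h y0 i - ((j%:R - i%:R) * h) *: F y| <=
    e * ((j%:R - i%:R) * h).
Proof.
move=> h0 M0 FM Fy /andP[il lj] jr xl; have ij := leq_trans il lj.
have := @euler_estimate h y0 (F y) e i (j - i) h0.
rewrite subnKC// natrB//; apply=> k kd; apply: Fy.
set q := (i + k)%N; have qj : (q <= j)%N.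
  by rewrite -(subnKC ij) leq_add2l ltnW.
have iq : (i <= q)%N by rewrite leq_addr.
have lip a b : (i <= a)%N -> (a <= b)%N -> (b <= j)%N ->
    `|euler h y0 b - euler h y0 a| <= M * ((j%:R - i%:R) * h).
  move=> ia ab bj; apply: (le_trans (@euler_lipschitz h y0 r M a b h0 M0 FM ab _)).
    by apply: le_lt_trans jr; rewrite !ler_wpM2r// ler_nat.
  by rewrite ler_wpM2l// ler_wpM2r// lerB// ler_nat.
apply: le_lt_trans xl; rewrite -(subrK (euler h y0 l) (euler h y0 q)) -addrA.
apply: (le_trans (ler_normD _ _)); rewrite lerD2r.
by case: (leqP l q) => lq; [exact: lip|rewrite distrC lip// ltnW].
Qed.

(* The Euler polygons of step [1 / (N + 1)] converge pointwise along an
   ultrafilter on [nat], so no equicontinuity argument is needed.  The estimate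
   over [u <= s <= w] gives both one-sided derivatives of [Y] at [s], including
   at the endpoints of [0, a], where solutions get glued. *)
Lemma peano y0 : continuous F -> exists2 a, 0 < a & exists2 Y : R -> 'cV[R]_p,
  Y 0 = y0 & forall s, 0 <= s <= a -> forall e, 0 < e ->
  exists2 d, 0 < d & forall u w, 0 <= u <= s -> s <= w <= a -> w - u < d ->
    `|Y w - Y u - (w - u) *: F (Y s)| <= e * (w - u).
Proof.
move=> cF; pose M := `|F y0| + 1.
have M0 : 0 < M by rewrite ltr_wpDl.
have [r r0 FM] : exists2 r, 0 < r & forall x, `|x - y0| < r -> `|F x| <= M.
  have [r r0 rP] := continuous_dist_le (cF y0) ltr01.
  exists r => // x /rP xr; rewrite -(subrK (F y0) (F x)) addrC.
  by apply: (le_trans (ler_normD _ _)); rewrite lerD2l.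
have [U [UU oU]] := @ultraFilterLemma nat \oo _.
pose h N : R := N.+1%:R^-1.
(* No interpolation: for [t >= 0], [X N t] is the vertex at the last grid time not exceeding [t], a
   step function of [t]. *)
pose k N (t : R) := Num.truncn (t * N.+1%:R).
pose X N t := euler (h N) y0 (k N t).
have h0 N : 0 <= h N by rewrite invr_ge0.
have kh N t : 0 <= t -> (k N t)%:R * h N <= t < (k N t)%:R * h N + h N.
  move=> t0; rewrite -{3}[h N]mul1r -mulrDl natr1 /h.
  rewrite ler_pdivrMr ?ltr0n// ltr_pdivlMr ?ltr0n//.
  by apply: truncn_itv; rewrite mulr_ge0.
have hU : h N @[N --> U] --> 0 by apply: cvg_trans cvg_harmonic; exact: cvg_app.
have khU t : 0 <= t -> (k N t)%:R * h N @[N --> U] --> t.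
  move=> t0; apply: (@squeeze_cvgr _ _ _ _ (fun N => t - h N) (fun=> t)).
  - near=> N; have /andP[k1 k2] := kh N t t0.
    by rewrite k1 lerBlDr (ltW k2).
  - by rewrite -[X in _ --> X]subr0; apply: cvgB => //; exact: cvg_cst.
  - exact: cvg_cst.
(* With this choice [a * M] is [r / 2], so up to time [a] every polygon stays in the ball where [M]
   bounds [F]. *)
pose a := r / (2 * M).
have a0 : 0 < a by rewrite divr_gt0// mulr_gt0.
have kr N t : 0 <= t <= a -> (k N t)%:R * h N * M < r.
  move=> /andP[t0 ta]; have /andP[k1 _] := kh N t t0.
  apply: (@le_lt_trans _ _ (a * M)).
    by rewrite ler_wpM2r ?(ltW M0)// (le_trans k1).
  rewrite /a invfM mulrA -(mulrA _ M^-1) mulVf ?gt_eqF// mulr1.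
  by rewrite ltr_pdivrMr// ltr_pMr// ltr1n.
have XU (t : R) : exists y : 'cV[R]_p, 0 <= t <= a ->
    X N t @[N --> U] --> y.
  (* The value 0 outside [[0, a]] is a mere default; inside, the vertices lie in a compact ball. *)
  have [ta|] := boolP (0 <= t <= a); last by exists 0.
  have [||y _ Xy] := @compact_ultra_cvg _ _ U (X ^~ t)
      [set x | `|x - y0| <= r] UU.
  - exact: cV_closed_ball_compact.
  - near=> N => /=; have kNr := kr N t ta.
    apply: le_trans (ltW kNr).
    by apply: (@euler_in_ball _ _ r) => //; exact: ltW.
  - by exists y.
have [Y XY] := choice XU.
exists a => //; exists Y.
  have Y0 : X N 0 @[N --> U] --> Y 0 by apply: XY; rewrite lexx ltW.
  have Xy : X N 0 @[N --> U] --> y0.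
    have -> : X ^~ 0 = cst y0.
      by apply/funext => N; rewrite /X /k mul0r truncn0.
    exact: cvg_cst.
  exact: (cvg_unique (@norm_hausdorff _ _) Y0 Xy).
move=> s sa e e0.
have [rho rho0 rhoP] := continuous_dist_le (cF (Y s)) e0.
(* [euler_straddle] needs [M * D N + |X N s - Y s| < rho]. Since [D N] is at most [w - u + h N],
   three terms arise, each below [rho / 4]: [M * (w - u)] by this choice of [d], the other two for
   [N] large along [U]. *)
exists (rho / 4 / M); first by rewrite !divr_gt0.
move=> u w /andP[u0 us] /andP[sw wa]; rewrite ltr_pdivlMr// => uw.
have ua : 0 <= u <= a by rewrite u0 (le_trans us)// (le_trans sw).
have wa' : 0 <= w <= a by rewrite wa (le_trans u0)// (le_trans us).
have s0 : 0 <= s by case/andP: sa.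
pose D N := ((k N w)%:R - (k N u)%:R) * h N.
have DU : D N @[N --> U] --> w - u.
  rewrite /D; under eq_fun do rewrite mulrBl.
  by apply: cvgB; apply: khU; [case/andP: wa'|].
have lhsU : `|X N w - X N u - D N *: F (Y s)| @[N --> U] -->
    `|Y w - Y u - (w - u) *: F (Y s)|.
  apply: cvg_norm; apply: cvgB; last exact: cvgZr_tmp.
  by apply: cvgB; exact: XY.
have rhsU : e * D N @[N --> U] --> e * (w - u) by exact: cvgMl_tmp.
(* It suffices to have the inequality for the polygons, eventually along [U]. *)
apply: (ler_cvg_to lhsU rhsU).
near=> N.
apply: (@euler_straddle _ _ r M _ (k N s) _ (Y s) e rho) => //; first exact: ltW.
- by rewrite !le_truncn// ler_wpM2r.
- exact: kr.
- have hN : M * h N < rho / 4.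
    rewrite mulrC -ltr_pdivlMr//.
    by near: N; apply: (cvgr_lt _ hU); rewrite !divr_gt0.
  have XN : `|Y s - X N s| < rho / 4.
    by near: N; apply: ((cvgrPdist_lt _ _).1 (XY s sa)); rewrite divr_gt0.
  have DN : D N <= w - u + h N.
    rewrite /D mulrBl; case/andP: wa' => w0 _.
    have /andP[kw _] := kh N w w0; have /andP[_ ku] := kh N u u0.
    by lra.
  have MD : M * D N <= (w - u) * M + M * h N.
    by rewrite [_ * M]mulrC -mulrDr ler_pM2l.
  by rewrite -/(X N s) distrC; rewrite -/(D N); lra.
Unshelve. all: by end_near. Qed.

End Peano.

(** * Continuity and prolongation of solutions *)

Section Solutions.
Context {R : realType} {p : nat}.

Lemma solution_continuous (F : 'cV[R]_p -> R -> 'cV[R]_p) (t0 : R) (T : \bar R)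
    (Y : R -> 'cV[R]_p) (s t : R) : is_solution F t0 T Y ->
  t0 <= s -> (t%:E < T)%E -> {within `[s, t], continuous Y}.
Proof.
move=> [t0T Y0 dY] t0s tT.
apply: (@continuous_subspaceW _ _ _ `[t0, t]%classic).
  by apply: subset_itvr; rewrite bnd_simp.
have [t0t|tt0] := ltP t0 t; last first.
  move: tt0; rewrite le_eqVlt => /orP[/eqP->|tt0].
    by rewrite set_itv1; exact: continuous_subspace1.
  by rewrite set_itv_ge ?bnd_simp -?ltNge//; exact: continuous_subspace0.
have cY x : t0 < x -> x <= t -> {for x, continuous Y}.
  move=> t0x xt; have xT : (x%:E < T)%E by rewrite (le_lt_trans _ tT)// lee_fin.
  apply/differentiable_continuous/derivable1_diffP.
  exact: (@ex_derive _ _ _ _ _ _ _ (dY x t0x xT)).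
apply/continuous_within_itvP => //; split.
- by move=> x /itvP xt; apply: cY; rewrite ?xt.
- exact: right_quotient_cvg Y0.
- by apply/cvg_at_left_filter; exact: cY.
Qed.

(** [F] is bounded by some [M] on the ball, so [Y] is Lipschitz and has a limit [L] at [T]. The
    prolongation [Z] follows [Y] before [T] and a Peano solution issued from [L] afterwards. *)
Lemma bounded_solution_extends (F : 'cV[R]_p -> 'cV[R]_p) (t0 T : R)
    (Y : R -> 'cV[R]_p) (c : 'cV[R]_p) (r : R) : continuous F ->
  is_solution (fun x _ => F x) t0 T%:E Y ->
  (forall t, t0 <= t < T -> `|Y t - c| <= r) ->
  exists T' Z, [/\ (T%:E < T')%E, is_solution (fun x _ => F x) t0 T' Z &
    forall t, t0 <= t -> (t%:E < T%:E)%E -> Z t = Y t].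
Proof.
move=> cF solY Yr; have [+ Y0 dY] := solY; rewrite lte_fin => t0T.
have [M M0 FM] : exists2 M, 0 < M & forall x, `|x - c| <= r -> `|F x| <= M.
  have /ex_strict_bound_gt0[M M0 /= MF] :
      bounded_set (F @` [set x | `|x - c| <= r]).
    apply/compact_bounded/continuous_compact; last exact: cV_closed_ball_compact.
    exact: continuous_subspaceT.
  by exists M => // x xr; apply/ltW/MF; exists x.
have Yest e v s t : 0 <= e -> t0 <= s -> s <= t -> t < T ->
    (forall x, s <= x <= t -> `|F (Y x) - v| <= e) ->
    `|Y t - Y s - (t - s) *: v| <= e * (t - s).
  move=> e0 t0s st tT Fe; apply: (mean_value_estimate st e0 _ _ Fe).
    by apply: solution_continuous solY _ _ => //; rewrite lte_fin.
  move=> x /andP[sx xt]; apply: dY; first exact: le_lt_trans sx.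
  by rewrite lte_fin (lt_trans xt).
have [U [UU TU]] := ultraFilterLemma (at_left_proper_filter T).
have near_T t : t < T -> \forall s \near U, t <= s < T.
  move=> tT; apply: TU; near=> s; apply/andP; split.
    by apply: ltW; near: s; exact: nbhs_left_gt.
  by near: s; exact: nbhs_left_lt.
have [|L _ YL] := compact_ultra_cvg UU (@cV_closed_ball_compact _ _ c r) (f := Y).
  by apply: filterS (near_T t0 t0T) => s; exact: Yr.
have idU : (s : R) @[s --> U] --> T.
  by apply: cvg_trans (cvg_at_left_filter cvg_id); exact: cvg_app.
(* The right end [s] of the estimates [Yest] is sent to [T]. *)
have limU e v t : t < T -> (\forall s \near U,
    `|Y s - Y t - (s - t) *: v| <= e * (s - t)) ->
    `|L - Y t - (T - t) *: v| <= e * (T - t).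
  move=> tT; apply: ler_cvg_to.
    apply: cvg_norm; apply: cvgB.
      by apply: cvgB => //; exact: cvg_cst.
    by apply: cvgZr_tmp; apply: cvgB => //; exact: cvg_cst.
  by apply: cvgMl_tmp; apply: cvgB => //; exact: cvg_cst.
(* Case [v := 0], [e := M]: the ultrafilter limit [L] is thus the true left limit of [Y] at [T]. *)
have lipL t : t0 <= t < T -> `|L - Y t| <= M * (T - t).
  move=> /andP[t0t tT]; rewrite -[L - _]subr0 -(scaler0 _ (T - t)).
  apply: limU => //; apply: filterS (near_T t tT) => s /andP[ts sT].
  apply: Yest => //; first exact: ltW.
  move=> x /andP[tx xs]; rewrite subr0; apply/FM/Yr.
  by rewrite (le_trans t0t)//= (le_lt_trans xs).
have leftL e : 0 < e -> exists2 d, 0 < d & forall h, 0 < h < d -> t0 <= T - h ->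
    `|L - Y (T - h) - h *: F L| <= e * h.
  move=> e0; have [d d0 dF] := continuous_dist_le (cF L) e0.
  (* For [h < d / M], [lipL] keeps [Y] within [d] of [L] on [[T - h, T[], so its velocity there is
     within [e] of [F L]. *)
  exists (d / M); first exact: divr_gt0.
  move=> h /andP[h0]; rewrite ltr_pdivlMr// => hd t0h.
  have hT : T - h < T by rewrite ltrBlDr ltrDl.
  have := limU e (F L) _ hT; rewrite subKr; apply.
  apply: filterS (near_T _ hT) => s /andP[hs sT].
  apply: Yest => //; first exact: ltW.
  move=> x /andP[hx xs]; apply: dF; rewrite distrC.
  have xT := le_lt_trans xs sT.
  apply: le_lt_trans (lipL x _) _; first by rewrite xT (le_trans t0h).
  by apply: le_lt_trans hd; rewrite mulrC ler_pM2r// lerBlDl -lerBlDr.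
have [a a0 [W W0 dW]] := peano L cF.
pose Z t := if t < T then Y t else W (t - T).
have ZY t : t < T -> Z t = Y t by rewrite /Z => ->.
have ZW t : T <= t -> Z t = W (t - T) by rewrite /Z ltNge => ->.
exists (T + a)%:E, Z; split=> [||t _]; [by rewrite lte_fin ltrDl| |exact: ZY].
split.
- by rewrite lte_fin ltr_wpDr// ltW.
- rewrite ZY//; apply: cvg_trans Y0; apply: near_eq_cvg; near=> h.
  by rewrite ZY// -ltrBrDl; near: h; apply: nbhs_right_lt; rewrite subr_gt0.
move=> t t0t; rewrite lte_fin => ta.
have [tT|Tt] := ltP t T.
  rewrite ZY//; apply: near_eq_is_derive (dY t t0t _); last by rewrite lte_fin.
  by near=> x; rewrite ZY//; near: x; exact: lt_nbhsl.
have sa : 0 <= t - T < a by rewrite subr_ge0 Tt ltrBlDl.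
have sa' : 0 <= t - T <= a by case/andP: sa => -> /ltW ->.
case/andP: sa => s0 sa.
apply: is_derive_sides.
  apply: cvg_right_quotient => e e0; have [d d0 dP] := dW _ sa' _ e0.
  exists (Num.min d (a - (t - T))); first by rewrite lt_min d0 subr_gt0.
  move=> h; rewrite lt_min => /and3P[h0 hd ha].
  have := dP (t - T) (t - T + h); rewrite !ZW ?(le_trans Tt) ?lerDl ?(ltW h0)//.
  have -> : t - T + h - (t - T) = h by ring.
  rewrite [t + h - T]addrAC; apply=> //.
    by rewrite s0 lexx.
  by rewrite /=; lra.
(* At the junction [t = T] the left quotient involves the old solution and is controlled by [leftL];
   after [T] both sides come from the Peano solution. *)
apply: cvg_left_quotient => e e0; move: Tt; rewrite le_eqVlt => /orP[/eqP <-|Tt].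
  have [d d0 dP] := leftL _ e0.
  exists (Num.min d (T - t0)); first by rewrite lt_min d0 subr_gt0.
  move=> h; rewrite lt_min => /and3P[h0 hd ha].
  rewrite (ZW T)// subrr W0 ZY ?ltrBlDr ?ltrDl//; apply: dP; rewrite ?h0//.
  by rewrite lerBrDl -lerBrDr ltW.
have [d d0 dP] := dW _ sa' _ e0.
exists (Num.min d (t - T)); first by rewrite lt_min d0 subr_gt0.
move=> h; rewrite lt_min => /and3P[h0 hd ht].
have := dP (t - T - h) (t - T); rewrite !ZW ?(ltW Tt)//; last first.
  by rewrite lerBrDl -lerBrDr ltW.
rewrite [t - h - T]addrAC subKr; apply=> //; lra.
Unshelve. all: by end_near. Qed.

End Solutions.

(** * Lyapunov's direct method, with [dV] the derivative of [V] along [F] *)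

Section Lyapunov.
Context {R : realType} {p : nat}.
Variables (F : 'cV[R]_p -> 'cV[R]_p) (V dV : 'cV[R]_p -> R) (X : 'cV[R]_p).
Hypothesis diffV : forall x, differentiable V x.
Hypothesis dVE : forall x, 'd V x (F x) = dV x.
Hypothesis dV_le0 : forall x, dV x <= 0.

Let V_continuous : continuous V.
Proof. by move=> x; exact: differentiable_continuous. Qed.

Section AlongSolution.
Variables (t0 : R) (T : \bar R) (Y : R -> 'cV[R]_p).
Hypothesis solY : is_solution (fun x _ => F x) t0 T Y.

Lemma lyapunov_increment k s t : t0 <= s <= t -> (t%:E < T)%E ->
  (forall x, s <= x <= t -> dV (Y x) <= k) ->
  V (Y t) - V (Y s) <= k * (t - s).
Proof.
move=> /andP[t0s st] tT dVk; have [_ _ dY] := solY.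
have [||x] := @MVT_segment _ (V \o Y) (dV \o Y) s t st.
- move=> x /itvP xst; have xT : (x%:E < T)%E.
    by apply: le_lt_trans tT; rewrite lee_fin xst.
  have dYx := dY x (le_lt_trans t0s _) xT.
  have {}dYx : is_derive x 1 Y (F (Y x)) by apply: dYx; rewrite xst.
  have diffY : differentiable Y x by apply/derivable1_diffP; case: dYx.
  have diffVY : differentiable (V \o Y) x by exact: differentiable_comp.
  apply: DeriveDef; first exact/derivable1_diffP.
  have dYE : 'd Y x 1 = F (Y x).
    by rewrite -deriveE// (@derive_val _ _ _ _ _ _ _ dYx).
  by rewrite deriveE// diff_comp//= dYE dVE.
- move=> x; apply: (cvg_comp Y V (solution_continuous solY t0s tT (x := x))).
  exact: V_continuous.
- rewrite in_itv/= => xst ->.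
  by rewrite ler_wpM2r ?subr_ge0//; exact: dVk.
Qed.

Lemma lyapunov_nonincreasing s t : t0 <= s <= t -> (t%:E < T)%E ->
  V (Y t) <= V (Y s).
Proof.
move=> st tT; rewrite -subr_le0 -(mul0r (t - s)).
by apply: lyapunov_increment => // x _.
Qed.

(** To leave the ball, the solution would have to meet the sphere, by the intermediate value
    theorem; there [V] is at least [c], but it started below [c] and cannot increase. *)
Lemma lyapunov_trap r c : (forall x, `|x - X| = r -> c <= V x) ->
  `|Y t0 - X| < r -> V (Y t0) < c ->
  forall t, t0 <= t -> (t%:E < T)%E -> `|Y t - X| < r.
Proof.
move=> Vc Y0r Y0c t t0t tT; rewrite ltNge; apply/negP => rY.
have [||s] := @IVT _ (fun x => `|Y x - X|) t0 t r t0t.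
- move=> x; have cY := solution_continuous solY (lexx t0) tT (x := x).
  exact: (cvg_comp Y (fun y => `|y - X|) cY (@dist_continuous _ _ X _)).
- by rewrite ge_min (ltW Y0r) le_max rY orbT.
rewrite in_itv/= => /andP[t0s st] /Vc; apply/negP; rewrite -ltNge.
apply: le_lt_trans Y0c; apply: lyapunov_nonincreasing; first by rewrite lexx.
by apply: le_lt_trans tT; rewrite lee_fin.
Qed.

End AlongSolution.

Variable O : set 'cV[R]_p.
Hypothesis F_continuous : continuous F.
Hypothesis dV_continuous : continuous dV.
Hypothesis O_nbhs : nbhs X O.
Hypothesis V_min : forall x, O x -> x <> X -> V X < V x.
Hypothesis dV_lt0 : forall x, O x -> x <> X -> dV x < 0.

(** The annulus is compact and omits [X]. With [e = r] this gives the barrier on the sphere; with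
    [e] small it turns a low value of [V] into closeness to [X]. *)
Lemma lyapunov_annulus r e : 0 < e -> (forall x, `|x - X| <= r -> O x) ->
  exists2 c, V X < c & forall x, `|x - X| <= r -> e <= `|x - X| -> c <= V x.
Proof.
move=> e0 rO.
have [||c Vc cP] := @compact_gt_lower_bound _ _
  ([set x | `|x - X| <= r] `&` [set x | e <= `|x - X|]) V (V X) _ V_continuous.
- by apply: compact_ge; [exact: cV_closed_ball_compact|exact: dist_continuous].
- move=> x [/= /rO Ox ex]; apply: V_min => // xX.
  by move: ex; rewrite xX subrr normr0 leNgt e0.
- by exists c => // x xr ex; exact: cP.
Qed.

(** Once [V] is below the level [c] of the annulus it remains so, and the solution stays within [e]
    of [X]. If [V] never went below [c], the solution would stay in a compact set without [X], where
    [dV <= - d < 0], and [V] would decrease without bound. *)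
Lemma lyapunov_convergence t0 Y r : is_solution (fun x _ => F x) t0 +oo%E Y ->
  (forall x, `|x - X| <= r -> O x) ->
  (forall t, t0 <= t -> `|Y t - X| < r) ->
  Y t @[t --> +oo] --> X.
Proof.
move=> solY rO Yr; apply/cvgrPdist_lt => e e0.
have [c Xc cP] := lyapunov_annulus e0 rO.
have [t1 t01 Vt1] : exists2 t1, t0 <= t1 & V (Y t1) < c.
  apply: contrapT => nVc.
  have cV t : t0 <= t -> c <= V (Y t).
    by move=> t0t; rewrite leNgt; apply/negP => Vtc; apply: nVc; exists t.
  have [||x|d d0 dP] := @compact_gt_lower_bound _ _
    ([set x | `|x - X| <= r] `&` [set x | c <= V x]) (fun x => - dV x) 0.
  - by apply: compact_ge => //; exact: cV_closed_ball_compact.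
  - by move=> x; exact: (cvgN (@dV_continuous x)).
  - move=> [/= /rO Ox cVx]; rewrite oppr_gt0; apply: dV_lt0 => // xX.
    by move: cVx; rewrite xX leNgt Xc.
  (* By this time [V] has lost at least [V (Y t0) - c + 1], one more than it can while staying above
     [c]. *)
  pose t := t0 + (V (Y t0) - c + 1) / d.
  have t0t : t0 <= t.
    by rewrite lerDl divr_ge0// ?(ltW d0)// addr_ge0// subr_ge0 cV.
  have := @lyapunov_increment t0 +oo%E Y solY (- d) t0 t.
  rewrite lexx t0t => /(_ isT (ltry _)) incr.
  have {}incr : V (Y t) - V (Y t0) <= - d * (t - t0).
    apply: incr => x /andP[t0x _]; rewrite lerNr; apply: dP.
    by split => /=; [exact/ltW/Yr|exact: cV].
  have dt : d * (t - t0) = V (Y t0) - c + 1.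
    by rewrite /t addrAC subrr add0r mulrC divfK// gt_eqF.
  by have := cV t t0t; lra.
near=> t.
have t1t : t1 <= t by near: t; apply: nbhs_pinfty_ge; exact: num_real.
have t0t := le_trans t01 t1t.
rewrite distrC ltNge; apply/negP => /(cP _ (ltW (Yr t t0t))).
apply/negP; rewrite -ltNge; apply: le_lt_trans Vt1.
by apply: (lyapunov_nonincreasing solY); rewrite ?t01 ?ltry.
Unshelve. all: by end_near. Qed.

Theorem lyapunov_asymptotically_stable t0 :
  asymptotically_stable (fun x _ => F x) t0 X.
Proof.
suff stab N : nbhs X N -> exists Nbar, [/\ nbhs X Nbar, Nbar `<=` N,
    solutions_remain (fun x _ => F x) t0 Nbar N &
    solutions_converge (fun x _ => F x) t0 Nbar X].
  by split => // N /stab[Nbar [? ? ? _]]; exists Nbar.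
move=> XN; have [r' /= r'0 r'P] := (nbhs_ballP _ _).1 (filterI XN O_nbhs).
(* Halving puts the closed ball of radius [r] inside the open ball of radius [r']. *)
pose r := r' / 2; have r0 : 0 < r by rewrite divr_gt0.
have {}r'P x : `|x - X| <= r -> N x /\ O x.
  move=> xr; apply: r'P; rewrite -ball_normE/= distrC (le_lt_trans xr)//.
  by rewrite ltr_pdivrMr// ltr_pMr// ltr1n.
have rO x : `|x - X| <= r -> O x by move=> /r'P[].
have [c Xc cP] := lyapunov_annulus r0 rO.
pose Nbar := [set x | `|x - X| < r /\ V x < c].
have trapped T Y : is_solution (fun x _ => F x) t0 T Y -> Nbar (Y t0) ->
    forall t, t0 <= t -> (t%:E < T)%E -> `|Y t - X| < r.
  move=> solY [Y0r Y0c]; apply: (lyapunov_trap solY _ Y0r Y0c) => x xr.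
  by apply: cP; rewrite xr.
have remain : solutions_remain (fun x _ => F x) t0 Nbar N.
  move=> T Y [solY maxY] Y0; have trap := trapped T Y solY Y0.
  have Too : T = +oo%E.
    (* A finite [T] contradicts maximality because the trapped solution is bounded; [-oo]
       contradicts [t0 < T]. *)
    case: T solY maxY trap => [T| |[]//] solY maxY trap //.
    case: maxY; apply: (bounded_solution_extends F_continuous solY (c := X) (r := r)).
    by move=> t /andP[t0t tT]; apply/ltW/trap => //; rewrite lte_fin.
  split=> // t t0t; apply: (r'P _ _).1; apply/ltW/trap; first exact: ltW.
  by rewrite Too ltry.
exists Nbar; split => //.
- have Xr : \forall x \near X, `|x - X| < r.
    by apply: (cvgr_lt _ (@dist_continuous _ _ X X)); rewrite subrr normr0.
  have XVc : \forall x \near X, V x < c.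
    exact: (cvgr_lt _ (@V_continuous X)).
  by apply: filterS2 Xr XVc => x.
- by move=> x [/ltW/r'P[]].
- move=> T Y maxY Y0; have [Too _] := remain T Y maxY Y0.
  rewrite {}Too in maxY; have [solY _] := maxY.
  apply: (lyapunov_convergence solY rO) => t t0t.
  by apply: (trapped _ _ solY Y0) => //; exact: ltry.
Qed.

End Lyapunov.

(** * Positive definiteness of the inverse Gram matrix *)

Section Gram.
Context {R : realType}.

Lemma mulmx_trmxE (n : nat) (u v : 'cV[R]_n) :
  (u^T *m v) 0 0 = \sum_i u i 0 * v i 0.
Proof. by rewrite mxE; apply: eq_bigr => i _; rewrite mxE. Qed.

Lemma gram_ge0 (n : nat) (u : 'cV[R]_n) : 0 <= (u^T *m u) 0 0.
Proof.
by rewrite mulmx_trmxE sumr_ge0// => i _; rewrite -expr2 sqr_ge0.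
Qed.

Lemma gram_eq0 (n : nat) (u : 'cV[R]_n) : (u^T *m u) 0 0 = 0 -> u = 0.
Proof.
rewrite mulmx_trmxE => /eqP; rewrite psumr_eq0 => [/allP u0|i _]; last first.
  by rewrite -expr2 sqr_ge0.
apply/matrixP => i j; rewrite ord1 mxE; apply/eqP.
by rewrite -sqrf_eq0 expr2; apply: u0; exact: mem_index_enum.
Qed.

Variables (m n : nat) (A : 'M[R]_(m, n)).
Hypothesis rankA : \rank A = n.

(** If [v *m A^T *m A = 0] for a row [v], then [v *m A^T] has zero squared length, so it vanishes,
    and full rank gives [v = 0]. *)
Lemma gram_unitmx : A^T *m A \in unitmx.
Proof.
rewrite -row_free_unit; apply: inj_row_free => v vA0.
have ArF : row_free A^T by rewrite /row_free mxrank_tr rankA.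
apply: (row_free_inj ArF); rewrite mul0mx.
apply: trmx_inj; rewrite trmx0; apply: gram_eq0.
by rewrite trmxK trmx_mul trmxK mulmxA -(mulmxA v) vA0 mul0mx mxE.
Qed.

(** Substituting [v = A^T *m A *m w] exhibits the form as a squared length. *)
Lemma inv_gram_form (v : 'cV[R]_n) : let w := invmx (A^T *m A) *m v in
  (v^T *m w) 0 0 = ((A *m w)^T *m (A *m w)) 0 0.
Proof.
move=> w; have vE : v = A^T *m A *m w by rewrite mulKVmx ?gram_unitmx.
by rewrite {1}vE !trmx_mul trmxK !mulmxA.
Qed.

Lemma inv_gram_form_ge0 (v : 'cV[R]_n) :
  0 <= (v^T *m (invmx (A^T *m A) *m v)) 0 0.
Proof. by rewrite inv_gram_form gram_ge0. Qed.

Lemma inv_gram_form_gt0 (v : 'cV[R]_n) : v <> 0 ->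
  0 < (v^T *m (invmx (A^T *m A) *m v)) 0 0.
Proof.
move=> v0; rewrite lt_def inv_gram_form_ge0 andbT inv_gram_form.
apply/eqP => /gram_eq0 Aw0; apply: v0.
by rewrite -[v](mulKVmx gram_unitmx) -mulmxA Aw0 mulmx0.
Qed.

End Gram.

(** * Gradients, Fermat's rule and the composite objective *)

Section Gradient.
Context {R : realType}.

Lemma diff_gradientE (n : nat) (V : 'cV[R]_n -> R) (x v : 'cV[R]_n) :
  differentiable V x -> 'd V x v = ((gradient V x)^T *m v) 0 0.
Proof.
move=> dV; rewrite mulmx_trmxE {1}(matrix_sum_delta v) linear_sum/=.
apply: eq_bigr => i _; rewrite big_ord1 linearZ/= mxE -deriveE//.
by rewrite mulrC.
Qed.

(** Fermat's rule for the restriction of [V] to each coordinate line through [x]. *)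
Lemma gradient_local_min_eq0 (n : nat) (V : 'cV[R]_n -> R) (x : 'cV[R]_n) :
  (forall y, differentiable V y) -> (\forall y \near x, V x <= V y) ->
  gradient V x = 0.
Proof.
move=> dV /(nbhs_ballP _ _).1[e /= e0 eP].
apply/matrixP => i j; rewrite ord1 !mxE; set d := delta_mx i 0.
pose h (t : R) := V (x + t *: d).
have dline t : is_diff t (fun t : R => x + t *: d) ( *:%R^~ d).
  by apply: is_diff_eq; rewrite add0r.
have diffh t : differentiable h t.
  exact: (@differentiable_comp _ _ _ _ (fun t : R => x + t *: d) V).
(* For [|t| < a] the point [x + t *: d] stays in the ball of radius [e]; the 1 makes the denominator
   visibly positive. *)
pose a := e / (1 + `|d|).
have a0 : 0 < a by rewrite divr_gt0// ltr_wpDr.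
have h0 : is_derive (0 : R) 1 h 0.
  apply: (@derive1_at_min _ h (- a) a 0).
  - by rewrite ge0_cp// ltW.
  - by move=> t _; exact/derivable1_diffP.
  - by rewrite in_itv/= oppr_lt0 a0.
  - move=> t; rewrite in_itv/= -ltr_norml => ta.
    rewrite /h scale0r addr0; apply: eP.
    rewrite -ball_normE/= opprD addrA subrr sub0r normrN normrZ.
    apply: (@le_lt_trans _ _ (`|t| * (1 + `|d|))).
      by rewrite ler_wpM2l// lerDr.
    by rewrite -ltr_pdivlMr// ltr_wpDr.
have := @derive_val _ _ _ _ _ _ _ h0.
rewrite deriveE// (@diff_comp _ _ _ _ (fun t : R => x + t *: d) V)//=.
by rewrite diff_val/= scale1r scale0r addr0 -deriveE.
Qed.

Lemma quadratic_form_continuous (T : topologicalType) (n : nat)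
    (u v : T -> 'cV[R]_n) : continuous u -> continuous v ->
  continuous (fun x => ((u x)^T *m v x) 0 0).
Proof.
move=> cu cv x; under eq_fun do rewrite mulmx_trmxE.
apply: cvg_big => [|i _]; first exact: add_continuous.
by apply: cvgM; [apply: (cvg_comp u (fun M : 'cV[R]_n => M i 0) (cu x))|
  apply: (cvg_comp v (fun M : 'cV[R]_n => M i 0) (cv x))];
  exact: coord_continuous.
Qed.

Variables (m n : nat) (f : 'cV[R]_n -> R) (g : 'cV[R]_m -> R).
Variable A : 'M[R]_(m, n).
Hypotheses (C1f : continuously_differentiable f)
  (C1g : continuously_differentiable g).

Lemma composite_objective_C1 :
  continuously_differentiable (composite_objective f g A).
Proof.
have [df cf] := C1f; have [dg cg] := C1g.
have dA x : differentiable (mulmx A : 'cV[R]_n -> 'cV[R]_m) x.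
  by apply: linear_differentiable => y; exact: mulmx_continuous.
have dgA x : differentiable (g \o mulmx A) x by exact: differentiable_comp.
split=> [x|]; first exact: differentiableD.
(* The chain rule: the adjoint of [A] appears when the differential of [g] at [A *m x] is applied to
   the columns of [A]. *)
have -> : gradient (composite_objective f g A) =
    fun x => gradient f x + A^T *m gradient g (A *m x).
  apply/funext => x; apply/matrixP => i j; rewrite ord1 !mxE.
  rewrite deriveE; last exact: differentiableD.
  rewrite (@diffD _ _ _ f (g \o mulmx A))//= -deriveE//; congr (_ + _).
  rewrite diff_comp//= diff_lin; last by move=> y; exact: mulmx_continuous.
  rewrite diff_gradientE// mulmx_trmxE.
  by apply: eq_bigr => k _; rewrite /= -colE [A^T _ _]mxE [col _ _ _ _]mxE mulrC.
have cgA : continuous (fun x => gradient g (A *m x)).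
  move=> x; apply: (cvg_comp (mulmx A) (gradient g) _ (@cg _)).
  exact: mulmx_continuous.
have cAgA : continuous (fun x => A^T *m gradient g (A *m x)).
  move=> x; apply: (cvg_comp _ (mulmx A^T) (@cgA x)).
  exact: mulmx_continuous.
by move=> x; exact: (cvgD (@cf x) (@cAgA x)).
Qed.

End Gradient.

(** * Application to the ADMM flow *)

Theorem theorem6 (R : realType) (n m : nat)
    (f : 'cV[R]_n -> R) (g : 'cV[R]_m -> R) (A : 'M[R]_(m, n))
    (t0 : R) (Xstar : 'cV[R]_n) :
  continuously_differentiable f ->
  continuously_differentiable g ->
  convex_function [set: 'cV[R]_n] f ->
  convex_function [set: 'cV[R]_m] g ->
  (n <= m)%N ->
  \rank A = n ->
  isolated_strict_minimizer (composite_objective f g A) Xstar ->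
  critical_point (admm_flow A (composite_objective f g A)) t0 Xstar /\
  asymptotically_stable (admm_flow A (composite_objective f g A)) t0 Xstar.
Proof.
set V := composite_objective f g A.
move=> C1f C1g _ _ _ rankA [W [openW WX gradV_neq0 V_min]].
have [diffV gradV_cts] : continuously_differentiable V.
  exact: composite_objective_C1.
have nbhsW : nbhs Xstar W by exact: open_nbhs_nbhs.
pose P := invmx (A^T *m A).
have Pgrad_cts : continuous (fun x => P *m gradient V x).
  move=> x; apply: (cvg_comp (gradient V) (mulmx P) (gradV_cts x)).
  exact: mulmx_continuous.
split=> [t _|].
  rewrite /admm_flow gradient_local_min_eq0// ?mulmx0 ?oppr0//.
  apply: filterS nbhsW => x Wx; have [->//|/eqP xX] := eqVneq x Xstar.
  exact/ltW/V_min.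
(* On [W], strict minimality provides the bound on [V], and isolation of the stationary point
   provides strict decrease, through the positive definiteness of [P]. *)
apply: (@lyapunov_asymptotically_stable _ _ (fun x => - (P *m gradient V x)) V
  (fun x => - ((gradient V x)^T *m (P *m gradient V x)) 0 0) _ _ _ _ W) => //.
- by move=> x; rewrite linearN/= diff_gradientE.
- by move=> x; rewrite oppr_le0; exact: inv_gram_form_ge0.
- by move=> x; exact: (cvgN (Pgrad_cts x)).
- by move=> x; exact: (cvgN (quadratic_form_continuous gradV_cts Pgrad_cts (x := x))).
- move=> x Wx xX; rewrite oppr_lt0; apply: inv_gram_form_gt0 => //.
  exact: gradV_neq0.
Qed.
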